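(* Let $G$ be an infinite countable group. Then the following are equivalent: (i) $\Xi_{\mathrm{tr}}(G)$ has a dense conjugacy class; (ii) For all finite alphabets $A_1,A_2$, all SFTs $X_1\subseteq A_1^G$, $X_2\subseteq A_2^G$, and all patterns $p_1$ (over $A_1$), $p_2$ (over $A_2$), if there exist recurrent points $x_i\in X_i$ such that $p_i$ occurs in $x_i$ for $i=1,2$, then there exist $x_i'\in X_i$ such that $p_i$ occurs in $x_i'$ for $i=1,2$, and $(x_1',x_2')$ is recurrent in $X_1\times X_2$.
   Context: $\Omega$ denotes the Cantor space; $\mathrm{Homeo}(\Omega)$ carries the uniform convergence topology. $\Xi(G)=\mathrm{Hom}(G,\mathrm{Homeo}(\Omega))$ is the Polish space of actions of $G$ on $\Omega$ by homeomorphisms, a closed subspace of $\mathrm{Homeo}(\Omega)^G$. $\mathrm{Homeo}(\Omega)$ acts on it by conjugation, $(f\cdot\xi)(g)=f\xi(g)f^{-1}$; orbits are called conjugacy classes. $\Xi_{\mathrm{tr}}(G)$ is the subspace of all $\xi\in\Xi(G)$ which are topologically transitive: for all non-empty open $U,V\subseteq\Omega$ there is $g\in G$ with $\xi(g)[U]\cap V\neq\emptyset$. For a finite alphabet $A$, $G$ acts on $A^G$ by $(g\cdot x)(h)=x(g^{-1}h)$. A subshift is a non-empty closed $G$-invariant subset of $A^G$. A pattern is a function $p\colon F\to A$ with $F\subseteq G$ finite; $C_p=\{x\in A^G:x|_F=p\}$; $p$ occurs in $x\in A^G$ if $g\cdot x\in C_p$ for some $g\in G$. A subshift is an SFT if it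 is of the form $A^G\setminus\bigcup_{p\in P}\bigcup_{g\in G}g\cdot C_p$ for a finite set $P$ of patterns. If $G$ acts by homeomorphisms on a compact space $Z$, a point $z\in Z$ is recurrent if for every open $U\ni z$ the set $\{g\in G:g\cdot z\in U\}$ is infinite. $X_1\times X_2$ carries the diagonal action of $G$. *)

(* Defs.v *)
From HB Require Import structures.
From mathcomp Require Import all_boot finmap.
From mathcomp Require Import all_classical all_reals topology cantor.

Set Implicit Arguments.
Unset Strict Implicit.
Unset Printing Implicit Defensive.

Local Open Scope classical_set_scope.
Local Open Scope group_scope.

Section Actions.
Variable G : groupType.

(* Homeo(Omega) is handled as a subset of the space of all self-maps of the
   Cantor space with the topology of uniform convergence. *)
Definition homeo : set {uniform cantor_space -> cantor_space} :=
  [set f | exists f' : cantor_space -> cantor_space,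
    [/\ cancel f f', cancel f' f,
        continuous (f : cantor_space -> cantor_space) & continuous f']].

(* Families of self-maps indexed by G, with the product topology; Xi and Xi_tr
   are subsets of this space and carry the induced topology. *)
Definition map_family : topologicalType :=
  {ptws G -> {uniform cantor_space -> cantor_space}}.

Definition Xi : set map_family :=
  [set xi | [/\ forall g, homeo (xi g),
                xi 1 = id &
                forall g h, xi (g * h) = xi g \o xi h]].

Definition top_transitive (xi : map_family) : Prop :=
  forall U V : set cantor_space, open U -> U !=set0 -> open V -> V !=set0 ->
    exists g : G, (xi g @` U) `&` V !=set0.

Definition Xi_tr : set map_family := Xi `&` top_transitive.

Definition conj_class (xi : map_family) : set map_family :=
  [set eta | exists f f' : cantor_space -> cantor_space,
    [/\ homeo f, cancel f f', cancel f' f &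
        forall g, eta g = f \o xi g \o f']].

(* A conjugacy class contained in B and dense in B for the topology induced on
   B, i.e. B is contained in its closure in the ambient space. *)
Definition has_dense_conj_class (B : set map_family) : Prop :=
  exists xi, [/\ B xi, conj_class xi `<=` B & B `<=` closure (conj_class xi)].

End Actions.

(* z is a recurrent point of the invariant subset X of T, where X carries the
   subspace topology. *)
Definition recurrent (G : groupType) (T : topologicalType) (act : G -> T -> T)
    (X : set T) (z : T) : Prop :=
  X z /\ forall U : set T, open U -> U z ->
    infinite_set [set g | (X `&` U) (act g z)].

Notation full_shift G A := {ptws G -> discrete_topology A}.

Section Subshifts.
Variables (G : groupType) (A : finType).

Definition shift (g : G) (x : full_shift G A) : full_shift G A :=
  fun h => x (g^-1 * h).

(* A pattern is a finite partial map p : {fmap G -> A}. *)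
Definition cylinder (p : {fmap G -> A}) : set (full_shift G A) :=
  [set x | forall h a, p.[? h]%fmap = Some a -> x h = a].

Definition occurs (p : {fmap G -> A}) (x : full_shift G A) : Prop :=
  exists g : G, cylinder p (shift g x).

Definition subshift (X : set (full_shift G A)) : Prop :=
  [/\ X !=set0, closed X & forall g x, X x -> X (shift g x)].

Definition SFT (X : set (full_shift G A)) : Prop :=
  subshift X /\
  exists2 P : set {fmap G -> A}, finite_set P &
    X = ~` \bigcup_(p in P) \bigcup_(g in [set: G]) (shift g @` cylinder p).

End Subshifts.

Definition diag_shift (G : groupType) (A1 A2 : finType) (g : G)
    (z : full_shift G A1 * full_shift G A2) :
    full_shift G A1 * full_shift G A2 :=
  (shift g z.1, shift g z.2).

(* Main.v *)
Require Import Defs.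
From HB Require Import structures.
From mathcomp Require Import all_boot finmap.
From mathcomp Require Import all_classical all_reals topology cantor.

(** Both conditions say that two dynamical systems can be run side by side
inside a single transitive action; the work is to pass between recurrent
symbolic points and transitive actions on the Cantor space.

From points to actions.  Let [y] be a recurrent point of a full shift.  Its
orbit closure need be neither perfect nor infinite, but its product with the
full shift on two letters is a perfect compact zero-dimensional metrizable
space, hence a Cantor space.  The product action is transitive: recurrence of
[y] supplies infinitely many elements that bring one open set of the orbit
closure to meet another, and all but finitely many of them do the same for
given cylinders of the full shift, which is mixing
([recurrent_realization]).  From actions to points: in a transitive action
some orbit visits every nonempty open set infinitely often ([dense_orbit]), and
the itinerary of such a point through a clopen partition is recurrent
([itinerary_recurrent]).

Dense class implies joint recurrence.  Given a recurrent point of an SFT in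
which a pattern occurs, realize it by a transitive action [eta].  The first
letter is a clopen partition whose itineraries lie in the SFT.  As an SFT is
cut out by a finite window, every action uniformly close to [eta] on finitely
many group elements has itineraries in the SFT as well.  A conjugate of the
action [xi] with dense class is such an action, so [xi] itself carries a
partition coding it into the SFT ([dense_class_coding]).  With two partitions
of this kind, for two SFTs, the pair of itineraries of one point of dense
orbit is the recurrent pair wanted ([joint_recurrence]).

Joint recurrence implies a dense class.  Up to conjugacy, a neighbourhood of
a transitive action [eta] is described by finitely many group elements [F]
and a number [n] of bits.  The patterns that the first [n] bits display along
[F] define an SFT, in which the itinerary of a point of dense [eta]-orbit is
recurrent and contains all these patterns ([windowed_coding]).  Since the
transitive actions form a separable space ([Xi_tr_separable]), countably many
such tasks are enough.  The hypothesis adds one task at a time to a recurrent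
point, while an ever larger finite part of the point, witnessing its
recurrence so far, is preserved; the limit is a single recurrent point
performing all tasks ([amalgam]).  Let [xi] be an action realizing it.  For
each task, the patterns of [xi] and the patterns of [eta] are the same finite
set and index two clopen partitions of the Cantor space; a homeomorphism
matching the partitions conjugates [xi] into the given neighbourhood of [eta]
([match_partitions], [conj_class_near]). *)

Set Implicit Arguments.
Unset Strict Implicit.
Unset Printing Implicit Defensive.

Local Open Scope classical_set_scope.

(** * Topologies in coordinates *)

Section ProductNbhs.
Variables (I : choiceType) (T : I -> topologicalType).

(** The right-hand side is a filter which converges to [f] in each coordinate,
hence converges to [f]. *)
Lemma prod_nbhsP (f : prod_topology T) (A : set (prod_topology T)) :
  nbhs f A <-> exists (s : seq I) (V : forall i, set (T i)),
    (forall i, nbhs (f i) (V i)) /\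
    [set g | forall i, i \in s -> V i (g i)] `<=` A.
Proof.
split.
- pose F : set_system (prod_topology T) := fun B =>
    exists (s : seq I) (V : forall i, set (T i)),
      (forall i, nbhs (f i) (V i)) /\
      [set g | forall i, i \in s -> V i (g i)] `<=` B.
  have FF : Filter F.
    split.
    + exists [::], (fun=> setT); split=> // i; exact: filterT.
    + move=> B C [s [V [nV sB]]] [t [W [nW tC]]].
      exists (s ++ t), (fun i => V i `&` W i); split.
        by move=> i; exact: filterI.
      move=> g /= gst; split.
        by apply: sB => i si; apply: (gst i _).1; rewrite mem_cat si.
      by apply: tC => i ti; apply: (gst i _).2; rewrite mem_cat ti orbT.
    + move=> B C BC [s [V [nV sB]]]; exists s, V; split=> // g /sB; exact: BC.
  suff : F --> f by apply.
  apply/cvg_sup => i U [_ [[W oW <-] Wf WU]].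
  exists [:: i], (fun j => [set y | forall e : j = i, W (ecast k (T k) e y)]).
  split.
    move=> j; have [ji|ji] := pselect (j = i); last first.
      by apply: filterS (filterT : nbhs (f j) setT) => y _ /= e.
    subst j; apply: filterS (open_nbhs_nbhs (conj oW Wf)) => y Wy e.
    by rewrite (Prop_irrelevance e erefl).
  move=> g /= /(_ i); rewrite mem_head => /(_ isT erefl) /= Wg.
  exact: WU.
- move=> [s [V [nV sA]]]; apply: filterS sA _.
  elim: s => [|i s IH].
    by apply: filterS (filterT : nbhs f setT) => g _ i.
  have Hi : nbhs f [set g : prod_topology T | V i (g i)].
    exact: (@proj_continuous I T i f _ (nV i)).
  apply: filterS (filterI Hi IH) => g [gi gs] j /=.
  by rewrite inE => /predU1P[->//|/gs].
Qed.

End ProductNbhs.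

Definition agree (n : nat) (x y : cantor_space) := forall i, i < n -> x i = y i.

Lemma agreeW n m x y : n <= m -> agree m x y -> agree n x y.
Proof. by move=> nm a i /leq_trans/(_ nm)/a. Qed.

Lemma agree_sym n x y : agree n x y -> agree n y x.
Proof. by move=> a i /a. Qed.

Lemma agree_trans n x y z : agree n x y -> agree n y z -> agree n x z.
Proof. by move=> a b i im; rewrite a// b. Qed.

Lemma agreeP x y : (forall n, agree n x y) -> x = y.
Proof. by move=> a; apply/funext => i; apply: (a i.+1). Qed.

Lemma seq_bound (T : eqType) (r : T -> nat) (s : seq T) :
  exists n, forall x, x \in s -> r x < n.
Proof.
elim: s => [|a s [n sn]]; first by exists 0.
exists (maxn (r a).+1 n) => x; rewrite inE leq_max => /predU1P[->|/sn->].
  by rewrite ltnSn.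
by rewrite orbT.
Qed.

Lemma cantor_nbhsP (x : cantor_space) (A : set cantor_space) :
  nbhs x A <-> exists n, agree n x `<=` A.
Proof.
split.
  move=> /(@prod_nbhsP nat (fun=> bool)) [s [V [nV sA]]].
  have [n sn] := seq_bound id s.
  exists n => y xy; apply: sA => i /sn/xy <-.
  exact: nbhs_singleton.
move=> [n nA]; apply/(@prod_nbhsP nat (fun=> bool)).
exists (iota 0 n), (fun i => [set x i]); split.
  by move=> i; exact: discrete_set1.
by move=> y /= xy; apply: nA => i i_n; rewrite xy// mem_iota.
Qed.

Lemma open_agree n (x : cantor_space) : open [set y | agree n x y].
Proof.
rewrite openE => y /= xy; apply/cantor_nbhsP; exists n => z yz.
exact: agree_trans yz.
Qed.

Lemma cantor_continuousP (f : cantor_space -> cantor_space) :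
  continuous f <->
  forall x n, exists m, forall y, agree m x y -> agree n (f x) (f y).
Proof.
split=> [cf x n|H x A].
  have /cf/cantor_nbhsP[m mA] : nbhs (f x) (agree n (f x)).
    by apply/cantor_nbhsP; exists n.
  by exists m => y /mA.
move=> /cantor_nbhsP[n nA]; have [m mP] := H x n.
by apply/cantor_nbhsP; exists m => y /mP/nA.
Qed.

(** Compactness in the form used throughout: a property with a parameter [n],
monotone in [n] and true around each point for some [n], is true everywhere for
one [n]. *)
Lemma cantor_uniform (P : nat -> cantor_space -> Prop) :
  (forall n m x, n <= m -> P n x -> P m x) ->
  (forall x, exists n, forall y, agree n x y -> P n y) ->
  exists n, forall x, P n x.
Proof.
move=> mono loc.
have /compact_near_coveringP cov := cantor_space_compact.
have [x _|n _ H] := cov nat \oo P _; last by exists n => x; apply: H => /=.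
have [n nP] := loc x; exists (agree n x, [set m | n <= m]).
  by split; [apply/cantor_nbhsP; exists n | exists n].
by move=> [y m] [/= xy nm]; apply: mono (nP _ xy).
Qed.

Lemma cantor_unif_continuous (f : cantor_space -> cantor_space) n :
  continuous f -> exists m, forall x y, agree m x y -> agree n (f x) (f y).
Proof.
move=> /cantor_continuousP cf.
apply: (@cantor_uniform
  (fun m x => forall y, agree m x y -> agree n (f x) (f y))).
  by move=> m k x mk H y xy; apply: H; exact: agreeW xy.
move=> x; have [m mP] := cf x n; exists m => y xy z yz.
apply: (@agree_trans _ _ (f x)); first exact/agree_sym/mP.
by apply/mP/(agree_trans xy).
Qed.

(** By compactness the uniformity of the Cantor space is the one given by
finite sets of coordinates; this turns uniform closeness of maps into agreement
of finitely many bits. *)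
Lemma cantor_entourageP (E : set (cantor_space * cantor_space)) :
  entourage E <-> exists n, forall x y, agree n x y -> E (x, y).
Proof.
split.
  move=> entE; apply: (@cantor_uniform
    (fun m x => forall y, agree m x y -> E (x, y))).
    by move=> m k x mk H y xy; apply: H; exact: agreeW xy.
  move=> x.
  have /cantor_nbhsP[n nA] := nbhs_entourage x (entourage_split_ent entE).
  have /cantor_nbhsP[m mA] := nbhs_entourage x
    (entourage_inv (entourage_split_ent entE)).
  exists (maxn n m) => y xy z yz; apply: (entourage_split x) => //.
    have /xsectionP := mA y (agreeW (leq_maxr _ _) xy).
    by [].
  have /xsectionP := nA z (agreeW (leq_maxl _ _) (agree_trans xy yz)).
  by [].
move=> [n nE].
have ent1 i : entourage [set p : cantor_space * cantor_space | p.1 i = p.2 i].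
  have oE : @entourage (initial_topology (@proj nat (fun=> bool) i))
      [set p : cantor_space * cantor_space | p.1 i = p.2 i].
    exists [set p : bool * bool | p.1 = p.2]; last by [].
    by move=> ? [b _ <-].
  pose w : {p : {classic nat} * set (cantor_space * cantor_space) |
      `[< @entourage (initial_topology (@proj nat (fun=> bool) p.1)) p.2 >]} :=
    @exist ({classic nat} * set (cantor_space * cantor_space))%type
      (fun p => `[< @entourage (initial_topology (@proj nat (fun=> bool) p.1))
        p.2 >]) (i, [set p | p.1 i = p.2 i]) (asboolT oE).
  exists [set p : cantor_space * cantor_space | p.1 i = p.2 i] => //.
  exists [fset w]%fset; first by move=> ? _; exact: in_setT.
  rewrite eqEsubset; split=> p /=.
    by move=> /(_ w); apply; rewrite /= inE.
  by move=> pi q; rewrite /= inE => /eqP ->.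
have : entourage [set p : cantor_space * cantor_space | agree n p.1 p.2].
  elim: n {nE} => [|n IH]; first exact: filterS (filterT).
  apply: filterS (filterI (ent1 n) IH) => -[x y] [/= xyn xy] i.
  by rewrite ltnS leq_eqVlt => /predU1P[->|/xy].
by apply: filterS => -[x y] /nE.
Qed.

Lemma map_family_closureP (G : groupType) (B : set (map_family G)) eta :
  closure B eta <->
  forall (F : seq G) n, exists2 eta', B eta' &
    forall g, g \in F -> forall x, agree n (eta g x) (eta' g x).
Proof.
split=> [cl F n|H A].
  have [|eta' [Beta' H]] := cl [set eta' : map_family G |
      forall g, g \in F -> forall x, agree n (eta g x) (eta' g x)].
    apply/(@prod_nbhsP G (fun=> {uniform cantor_space -> cantor_space})).
    exists F, (fun g => [set h | forall x, agree n (eta g x) (h x)]).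
    split=> // g; apply/uniform_nbhs.
    exists [set p | agree n p.1 p.2]; split.
      by apply/cantor_entourageP; exists n.
    by move=> h /= fh x; exact: fh.
  by exists eta'.
move=> /(@prod_nbhsP G (fun=> {uniform cantor_space -> cantor_space})).
move=> [F [V [nV FV]]].
have : forall g, exists n, [set h | forall x, agree n (eta g x) (h x)] `<=` V g.
  move=> g; have /uniform_nbhs[E [/cantor_entourageP[n nE] EV]] := nV g.
  by exists n => h Eh; apply: EV => x _ /=; exact: nE.
move=> /choice[r rV]; have [n Fn] := seq_bound r F.
have [eta' Beta' H'] := H F n.
exists eta'; split=> //; apply: FV => g Fg; apply: rV => x.
apply: (agreeW (ltnW (Fn _ Fg))); exact: H'.
Qed.

(** * Perfect subsets and clopen partitions of the Cantor space *)

Section PerfectEmbedding.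
Variable Y : set cantor_space.
Hypothesis Y0 : Y !=set0.
Hypothesis Ycl : forall x, (forall n, exists2 y, Y y & agree n x y) -> Y x.
Hypothesis Yperf : forall y n, Y y -> exists z, [/\ Y z, agree n y z & z <> y].

(** Perfectness makes the tree of prefixes of [Y] branch above every node; [m]
is the first level from [n] on at which it branches above the prefix of [y]. *)
Lemma perfect_branch y n : Y y -> exists m, [/\ n <= m,
  forall z, Y z -> agree n y z -> agree m y z &
  forall b, exists z, [/\ Y z, agree m y z & z m = b]].
Proof.
move=> Yy; pose P m := `[< exists z, [/\ Y z, agree n y z & z m <> y m] >].
have exP : exists m, P m.
  have [z [Yz yz zy]] := Yperf n Yy; apply: contrapT => nP; apply: zy.
  apply/funext => m; apply: contrapT => zm; apply: nP; exists m.
  by apply/asboolP; exists z.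
have [m /asboolP[z [Yz yz zm]] minm] := ex_minnP exP.
have agm w : Y w -> agree n y w -> agree m y w.
  move=> Yw yw i im; apply: contrapT => yiw.
  suff : m <= i by rewrite leqNgt im.
  by apply: minm; apply/asboolP; exists w; split=> // /esym.
exists m; split=> //.
  by rewrite leqNgt; apply/negP => mn; apply: zm; rewrite yz.
move=> b; have [<-|yb] := eqVneq (y m) b; first by exists y.
exists z; split=> //; first exact: agm.
by move: zm yb; case: (z m) (y m) b => -[] [].
Qed.

(** The coordinates of [x] are spent on the successive branchings of the tree
of prefixes of [Y]: at the [k]-th branching met, [e x] turns towards [x k].
Along a branch of [Y] the turns taken can be read off, which gives
surjectivity. *)
Lemma perfect_embedding : exists e : cantor_space -> cantor_space,
  [/\ continuous e, injective e & range e = Y].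
Proof.
have [y0 Yy0] := Y0.
have : forall s : cantor_space * nat, exists t : nat * (bool -> cantor_space),
    Y s.1 -> [/\ s.2 <= t.1, forall z, Y z -> agree s.2 s.1 z -> agree t.1 s.1 z
      & forall b, [/\ Y (t.2 b), agree t.1 s.1 (t.2 b) & t.2 b t.1 = b]].
  move=> [y n] /=; have [Yy|nYy] := pselect (Y y); last by exists (0, fun=> y).
  have [m [nm mY /choice[z zP]]] := perfect_branch n Yy.
  by exists (m, z).
move=> /choice[t tP].
(* A state is a point of Y with the length of the prefix that is settled. *)
pose step s b : cantor_space * nat := ((t s).2 b, (t s).1.+1).
pose S (x : cantor_space) := fix S k :=
  if k is k'.+1 then step (S k') (x k') else (y0, 0).
have SY x k : Y (S x k).1 by elim: k => //= k /tP[_ _ /(_ (x k))[]].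
have Sle x k : (S x k).2 <= (t (S x k)).1 by have [] := tP _ (SY x k).
have Slt x k : (S x k).2 < (S x k.+1).2 by rewrite ltnS.
have Sk x k : k <= (S x k).2 by elim: k => // k /leq_ltn_trans; apply.
have Sagree1 x k : agree (S x k).2 (S x k).1 (S x k.+1).1.
  by have [sl _ /(_ (x k))[_ + _]] := tP _ (SY x k); exact: agreeW.
have Smono x k j : (S x k).2 <= (S x (k + j)).2.
  by elim: j => [|j IH]; rewrite ?addn0// addnS (leq_trans IH) 1?ltnW.
have SagreeD x k j : agree (S x k).2 (S x k).1 (S x (k + j)).1.
  elim: j => [|j IH]; rewrite ?addn0// addnS.
  exact: agree_trans IH (agreeW (Smono x k j) _).
pose e (x : cantor_space) : cantor_space := fun i => (S x i.+1).1 i.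
have eS x k : agree (S x k).2 (S x k).1 (e x).
  move=> i ik; rewrite /e.
  have [ki|/ltnW ik'] := leqP k i.+1.
    by have := SagreeD x k (i.+1 - k) i ik; rewrite subnKC.
  by have := SagreeD x i.+1 (k - i.+1) i (Sk x i.+1); rewrite subnKC.
have Sext x x' k : agree k x x' -> S x k = S x' k.
  by elim: k => //= k IH xx'; rewrite IH ?(xx' k)// => i /ltnW; apply: xx'.
have ebranch x k : e x (t (S x k)).1 = x k.
  rewrite -(eS x k.+1) ?ltnSn//=.
  by have [_ _ /(_ (x k))[]] := tP _ (SY x k).
exists e; split.
- apply/cantor_continuousP => x n; exists n => y xy.
  apply: (agreeW (Sk x n)); apply: (@agree_trans _ _ (S x n).1).
    exact/agree_sym/eS.
  by rewrite (Sext _ _ _ xy); exact: eS.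
- move=> x y exy; suff H k : agree k x y by exact: agreeP.
  elim: k => // k IH i; rewrite ltnS leq_eqVlt => /predU1P[->|/IH//].
  by rewrite -ebranch exy (Sext _ _ _ IH) ebranch.
- rewrite eqEsubset; split=> [_ [x _ <-]|y Yy].
    apply: Ycl => n; exists (S x n).1 => //.
    exact/agree_sym/(agreeW (Sk x n))/eS.
  pose S' := fix S' k :=
    if k is k'.+1 then step (S' k') (y (t (S' k')).1) else (y0, 0).
  pose x : cantor_space := fun k => y (t (S' k)).1.
  have SS' k : S x k = S' k by elim: k => //= k ->.
  have Sy k : agree (S x k).2 (S x k).1 y.
    elim: k => // k IH.
    have [sl /(_ _ Yy IH) agt /(_ (x k))[_ H1 H2]] := tP _ (SY x k).
    move=> i /=; rewrite ltnS leq_eqVlt => /predU1P[->|ik].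
      by rewrite H2 /x SS'.
    by rewrite -H1// agt.
  exists x => //; apply: agreeP => n; apply: (agreeW (Sk x n)).
  exact: agree_trans (agree_sym (eS x n)) (Sy n).
Qed.

End PerfectEmbedding.

(** By compactness, a continuous injection is a homeomorphism onto its image. *)
Lemma embedding_open (e : cantor_space -> cantor_space) x n :
  continuous e -> injective e ->
  exists m, forall y, agree m (e x) (e y) -> agree n x y.
Proof.
move=> /cantor_continuousP ce ie.
apply: (@cantor_uniform (fun m y => agree m (e x) (e y) -> agree n x y)).
  by move=> m k y mk H /(agreeW mk).
move=> y; have [xy|nxy] := pselect (agree n x y).
  by exists n => z yz _; exact: agree_trans yz.
have [i exy] : exists i, e x i <> e y i.
  by apply: contrapT => /forallNP H; apply: nxy; rewrite (ie x y)//;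
    apply/funext => i; apply: contrapT => /H.
have [m mP] := ce y i.+1; exists (maxn m i.+1) => z yz exz; exfalso; apply: exy.
rewrite (exz i) ?leq_max ?ltnSn ?orbT//.
by rewrite (mP _ (agreeW (leq_maxl _ _) yz)).
Qed.

(** The fibres of a locally constant map are clopen, and flipping a coordinate
beyond those the map looks at shows that they are perfect. *)
Lemma clopen_embedding (K : Type) (q : cantor_space -> K) m k :
  (forall x y, agree m x y -> q x = q y) -> (exists x, q x = k) ->
  exists e : cantor_space -> cantor_space,
    [/\ continuous e, injective e & range e = [set x | q x = k]].
Proof.
move=> qm qk; apply: perfect_embedding => // [x /(_ m)[y <-]|x n qx].
  exact: qm.
exists (fun i => if i == maxn n m then ~~ x i else x i); split.
- by rewrite -qx; apply: qm => i im; rewrite ltn_eqF// leq_max im orbT.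
- by move=> i i_n; rewrite ltn_eqF// leq_max i_n.
- by move=> /(congr1 (@^~ (maxn n m))); rewrite eqxx; case: (x _).
Qed.

(** All nonempty clopen sets are copies of the Cantor space, so two finite
clopen partitions with the same index set are exchanged by a homeomorphism,
glued from homeomorphisms between corresponding pieces. *)
Lemma match_partitions (K : Type) (q q' : cantor_space -> K) m m' :
  (forall x y, agree m x y -> q x = q y) ->
  (forall x y, agree m' x y -> q' x = q' y) ->
  range q = range q' ->
  exists f f' : cantor_space -> cantor_space,
    [/\ continuous f, continuous f', cancel f f', cancel f' f &
        forall x, q' (f x) = q x].
Proof.
move=> qm qm' qq'.
have emb (r : cantor_space -> K) n : (forall x y, agree n x y -> r x = r y) ->
    exists d : K -> cantor_space -> cantor_space, forall k, range r k ->
      [/\ continuous (d k), injective (d k) & range (d k) = [set x | r x = k]].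
  move=> rn; have : forall k, exists d : cantor_space -> cantor_space,
    range r k -> [/\ continuous d, injective d & range d = [set x | r x = k]].
    move=> k; have [[x _ xk]|nk] := pselect (range r k); last by exists id.
    have [|d dP] := @clopen_embedding _ r n k rn; first by exists x.
    by exists d.
  by move=> /choice[d dP]; exists d.
(* On the fibre of k the map is d' k after the inverse of d k; it is continuous
   because the fibres are clopen. *)
have glue (r r' : cantor_space -> K) n
    (d d' : K -> cantor_space -> cantor_space) :
    (forall x y, agree n x y -> r x = r y) ->
    (forall k, range r k -> [/\ continuous (d k), injective (d k) &
      range (d k) = [set x | r x = k]]) ->
    (forall k, range r k -> [/\ continuous (d' k), injective (d' k) &
      range (d' k) = [set x | r' x = k]]) ->
    exists f : cantor_space -> cantor_space, continuous f /\
      forall k x, range r k -> f (d k x) = d' k x.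
  move=> rn dP d'P.
  have : forall x, exists y, d (r x) y = x.
    move=> x; have [|_ _ E] := dP (r x); first by exists x.
    by have : range (d (r x)) x; [rewrite E|move=> [y _ ?]; exists y].
  move=> /choice[u uP].
  have ud k x : range r k -> u (d k x) = x /\ r (d k x) = k.
    move=> rk; have [_ inj E] := dP _ rk.
    have rd : r (d k x) = k by have : range (d k) (d k x) by []; rewrite E.
    by split=> //; apply: inj; rewrite -{1}rd uP.
  exists (fun x => d' (r x) (u x)); split; last first.
    by move=> k x rk; have [-> ->] := ud k x rk.
  apply/cantor_continuousP => x l.
  have rx : range r (r x) by exists x.
  have [/cantor_continuousP/(_ (u x) l)[l1 l1P] _ _] := d'P _ rx.
  have [cd inj _] := dP _ rx.
  have [l2 l2P] := embedding_open (u x) l1 cd inj.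
  exists (maxn n l2) => y xy.
  have rxy : r x = r y by apply: rn; exact: agreeW (leq_maxl _ _) xy.
  rewrite -rxy; apply/l1P/l2P; rewrite uP rxy uP.
  exact: agreeW (leq_maxr _ _) xy.
have [d dP] := emb q m qm; have [d' dP'] := emb q' m' qm'.
have dP'q k (rk : range q k) : _ := dP' k (eq_ind _ (@^~ k) rk _ qq').
have dPq' k (rk : range q' k) : _ := dP k (eq_ind_r (@^~ k) rk qq').
have [f [cf fP]] := glue q q' m d d' qm dP dP'q.
have [f' [cf' fP']] := glue q' q m' d' d qm' dP' dPq'.
have sd x : exists2 y, d (q x) y = x & range q (q x).
  have rx : range q (q x) by exists x.
  have [_ _ E] := dP _ rx.
  have [y _ dy] : range (d (q x)) x by rewrite E.
  by exists y.
have sd' x : exists2 y, d' (q' x) y = x & range q' (q' x).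
  have rx : range q' (q' x) by exists x.
  have [_ _ E] := dP' _ rx.
  have [y _ dy] : range (d' (q' x)) x by rewrite E.
  by exists y.
exists f, f'; split=> // [x|x|x].
- have [y dy rx] := sd x; rewrite -[in LHS]dy fP// fP' ?dy//.
  by rewrite -qq'.
- have [y dy rx] := sd' x; rewrite -[in LHS]dy fP'// fP ?dy//.
  by rewrite qq'.
- have [y dy rx] := sd x; rewrite -[in LHS]dy fP//.
  have [_ _ E] := dP'q _ rx.
  by have : range (d' (q x)) (d' (q x) y) by []; rewrite E.
Qed.

(** * Limits of finite approximations *)

(** A construction by successive finite approximations.  At stage [k] only the
coordinates [c] with [b c < k] and [r c] below some bound are final.  The
function [b] gives the stage at which a coordinate comes into play: before it,
the coordinate may still be changed although [r c] is small.  Each requirement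
[Target k] is enforced by finitely much of the point built at stage [k], so it
passes to the limit, whereas the invariant [Inv] need not. *)
Lemma fusion (T : Type) (r b : T -> nat)
    (Inv Target : nat -> (T -> bool) -> Prop) :
  (exists y, Inv 0 y) ->
  (forall k y M, Inv k y -> exists y' M', [/\ Inv k.+1 y',
    forall c, r c < M -> b c < k -> y' c = y c &
    forall w, (forall c, r c < M' -> b c < k.+1 -> w c = y' c) ->
      Target k w]) ->
  exists w, forall k, Target k w.
Proof.
move=> [y0 Inv0] ext.
have : forall s : nat * ((T -> bool) * nat), exists t : (T -> bool) * nat,
    Inv s.1 s.2.1 -> [/\ Inv s.1.+1 t.1,
    forall c, r c < s.2.2 -> b c < s.1 -> t.1 c = s.2.1 c &
    forall w, (forall c, r c < t.2 -> b c < s.1.+1 -> w c = t.1 c) ->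
      Target s.1 w].
  move=> [k [y M]]; have [/ext /= ext'|nInv] := pselect (Inv k y).
    by have [y' [M' H]] := ext' M; exists (y', M').
  by exists (y, M) => /nInv.
move=> /choice[next nextP].
pose S := fix S k := if k is k'.+1 then
  let t := next (k', S k') in (t.1, maxn t.2 (S k').2.+1) else (y0, 0).
have InvS k : Inv k (S k).1 by elim: k => //= k /(nextP (_, _))[].
have SM k : (S k).2 < (S k.+1).2 by rewrite /= leq_max ltnSn orbT.
have leM k : k <= (S k).2 by elim: k => // k /leq_ltn_trans; apply.
have monoM k j : k <= j -> (S k).2 <= (S j).2.
  by move=> /subnKC <-; elim: (j - k) => [|i IH];
    rewrite ?addn0// addnS (leq_trans IH)// ltnW.
have stable k j c : k <= j -> r c < (S k).2 -> b c < k -> (S j).1 c = (S k).1 c.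
  move=> /subnKC <- rc bc; elim: (j - k) => [|i IH]; rewrite ?addn0// addnS.
  have [_ H _] := nextP (_, _) (InvS (k + i)).
  rewrite -IH -H//=; first by rewrite (leq_trans rc)// monoM// leq_addr.
  by rewrite (leq_trans bc)// leq_addr.
pose K c := (maxn (r c) (b c)).+1.
exists (fun c => (S (K c)).1 c) => k.
have [_ _] := nextP (_, _) (InvS k); apply=> c /= rc bc.
have rck : r c < (S k.+1).2 by rewrite /= leq_max rc.
change ((next (k, S k)).1 c) with ((S k.+1).1 c).
have [kK|/ltnW Kk] := leqP k.+1 (K c).
  exact: (stable _ _ _ kK rck bc).
apply/esym/(stable (K c) k.+1 c Kk); last by rewrite /K ltnS leq_maxr.
by rewrite (leq_trans _ (leM _))// /K ltnS leq_maxl.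
Qed.

Lemma countable_bij (T : Type) :
  countable [set: T] -> infinite_set [set: T] ->
  exists (c : T -> nat) (d : nat -> T), cancel c d /\ cancel d c.
Proof.
move=> cT iT; have /card_set_bijP[c] : ([set: T] #= [set: nat])%card.
  by rewrite card_eq_le; apply/andP; split=> //; apply/infiniteP.
by rewrite setTT_bijective => -[d]; exists c, d.
Qed.

(** * Transitive actions and recurrent points *)

Section Actions.
Local Open Scope group_scope.
Variable G : groupType.
Implicit Types (g h : G) (F L : seq G).

Lemma XiP (xi : map_family G) : Xi xi <->
  [/\ forall g, continuous (xi g : cantor_space -> cantor_space), xi 1 = id &
      forall g h, xi (g * h) = xi g \o xi h].
Proof.
split=> [[hx x1 xM]|[cx x1 xM]].
  by split=> // g; have [? []] := hx g.
split=> // g; exists (xi g^-1); split=> // x.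
  by rewrite -[LHS](congr1 (@^~ x) (xM _ _)) mulVg x1.
by rewrite -[LHS](congr1 (@^~ x) (xM _ _)) mulgV x1.
Qed.

Lemma top_transitiveP (xi : map_family G) : top_transitive xi <->
  forall x y n, exists g z, agree n x z /\ agree n y (xi g z).
Proof.
split=> [tr x y n|tr U V oU [x Ux] oV [y Vy]].
  have [||g [_ [[z xz <-] yz]]] :=
    tr _ _ (open_agree n x) _ (open_agree n y) _; [by exists x|by exists y|].
  by exists g, z.
have /cantor_nbhsP[n nU] := open_nbhs_nbhs (conj oU Ux).
have /cantor_nbhsP[m mV] := open_nbhs_nbhs (conj oV Vy).
have [g [z [xz yz]]] := tr x y (maxn n m); exists g, (xi g z); split.
  by exists z => //; apply: nU; exact: agreeW (leq_maxl _ _) xz.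
by apply: mV; exact: agreeW (leq_maxr _ _) yz.
Qed.

(** Recurrence under the shift, for the prodiscrete topology on [G -> B]. *)
Definition recurrent_fun (B : Type) (y : G -> B) := forall F L,
  exists2 g, g \notin L & forall h, h \in F -> y (g^-1 * h) = y h.

(** Recurrence when the alphabet [I -> bool] carries the product topology: only
finitely many bits of each letter are compared. *)
Definition recurrent_bits (I : Type) (y : G -> I -> bool) :=
  forall J : seq I, recurrent_fun (fun h => map (y h) J).

(** The fusion meets all basic open sets one after another.  Returns outside a
finite [L] come from perfectness: the target [y] is first replaced by a nearby
point that differs from the finitely many [xi g x], [g] in [L]. *)
Lemma dense_orbit (xi : map_family G) : Xi_tr xi ->
  exists x, forall y n L, exists2 g, g \notin L & agree n y (xi g x).
Proof.
move=> [/XiP[cxi _ _] /top_transitiveP tr].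
have [||x xP] := @fusion nat id (fun=> 0) (fun _ _ => True)
    (fun k x => forall s : seq bool, choice.unpickle k = Some s ->
       exists g, agree (size s) (nth false s) (xi g x)).
- by exists (fun=> false).
- move=> k y M _; case: (choice.unpickle k) => [s|]; last by exists y, 0.
  have [g [z [yz sz]]] := tr y (nth false s) (maxn M (size s)).
  have /cantor_continuousP/(_ z (size s))[m mP] := cxi g.
  exists z, m; split=> // [c cM _|w zw _ [<-]].
    by rewrite yz// leq_max cM.
  exists g; apply: agree_trans (agreeW (leq_maxr _ _) sz) _.
  by apply: mP => i im; rewrite zw.
exists x => y n L.
(* Diagonalization against the points xi g x, for g in L. *)
pose y' : cantor_space :=
  fun i => if i < n then y i else ~~ xi (nth 1 L (i - n)) x i.
pose s := mkseq y' (n + size L).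
have [g] := xP (choice.pickle s) s (choice.pickleK s).
rewrite size_mkseq => yg; exists g.
  apply/negP => gL; have iL : index g L < size L by rewrite index_mem.
  have := yg (n + index g L).
  rewrite ltn_add2l nth_mkseq ?ltn_add2l// => /(_ iL).
  rewrite /y' ltnNge leq_addr addKn nth_index//=.
  by case: (xi _ _ _).
by move=> i i_n; rewrite -yg ?nth_mkseq ?ltn_addr// /y' i_n.
Qed.

Section Realize.
Hypotheses (Gcount : countable [set: G]) (Ginf : infinite_set [set: G]).

Lemma exists_notin L : exists g, g \notin L.
Proof.
apply: contrapT => /forallNP gL; apply: Ginf.
apply: (@sub_finite_set _ _ [set` L]); last exact: finite_seq.
by move=> g _ /=; apply: contrapT => /negP /gL.
Qed.

(** The space is the orbit closure of [y] times the full shift on two letters,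
laid out in the Cantor space through a bijection of [nat] with
[G * option I]; the bits at [(h, None)] form the full shift. *)
Lemma recurrent_realization (I : countType) (y : G -> I -> bool) :
  recurrent_bits y ->
  exists (eta : map_family G) (p : cantor_space -> G -> I -> bool),
  [/\ Xi_tr eta,
      forall h i, exists n, forall x x', agree n x x' -> p x h i = p x' h i,
      forall g x h, p (eta g x) h = p x (g^-1 * h),
      forall x F (J : seq I), exists g,
        forall h i, h \in F -> i \in J -> p x h i = y (g^-1 * h) i &
      exists x, p x = y].
Proof.
move=> yrec.
have [c [d [cK dK]]] : exists (c : G * option I -> nat) d,
    cancel c d /\ cancel d c.
  apply: countable_bij.
    by rewrite -setXTT; apply: countableX.
  move=> /(finite_image fst); apply: contra_not Ginf; apply: sub_finite_set.
  by move=> g _; exists (g, None).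
pose Y : set cantor_space := fun w => forall F (J : seq I), exists g,
  forall h i, h \in F -> i \in J -> w (c (h, Some i)) = y (g^-1 * h) i.
pose sigma g (w : cantor_space) : cantor_space :=
  fun k => w (c (g^-1 * (d k).1, (d k).2)).
pose w0 : cantor_space :=
  fun k => if (d k).2 is Some i then y (d k).1 i else false.
have Yw0 : Y w0 by move=> F J; exists 1 => h i _ _; rewrite /w0 cK invg1 mul1g.
have Ysigma g w : Y w -> Y (sigma g w).
  move=> Yw F J; have [t tP] := Yw [seq g^-1 * h | h <- F] J.
  exists (g * t) => h i hF iJ; rewrite /sigma cK/= tP ?map_f//.
  by rewrite invgM mulgA.
have [||w n Yw|e [ce ie eY]] := @perfect_embedding Y; first by exists w0.
- move=> w Yw F J.
  have [n nP] := seq_bound c [seq (h, Some i) | h <- F, i <- J].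
  have [w' /(_ F J)[g gP] ww'] := Yw n; exists g => h i hF iJ.
  rewrite ww' ?gP//; apply: nP; apply/allpairsP; exists (h, i); split=> //=.
- have [h hn] := exists_notin [seq (d k).1 | k <- iota 0 n].
  have cn : n <= c (h, None).
    rewrite leqNgt; apply: contra hn => hn; apply/mapP.
    by exists (c (h, None)); rewrite ?mem_iota// cK.
  exists (fun k => if k == c (h, None) then ~~ w k else w k); split.
  + move=> F J; have [g gP] := Yw F J; exists g => f i fF iJ.
    by rewrite (can_eq cK) xpair_eqE andbF gP.
  + by move=> k kn; rewrite ltn_eqF// (leq_trans kn).
  + by move=> /(congr1 (@^~ (c (h, None)))); rewrite eqxx; case: (w _).
have : forall w, exists x, Y w -> e x = w.
  move=> w; have [Yw|nYw] := pselect (Y w); last by exists w.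
  by have [x _ ex] : range e w by [rewrite eY|]; exists x.
move=> /choice[u uP].
have Ye x : Y (e x) by rewrite -eY; exists x.
pose eta : map_family G := fun g x => u (sigma g (e x)).
have eeta g x : e (eta g x) = sigma g (e x) by exact/uP/Ysigma.
have eta_cont g : continuous (eta g : cantor_space -> cantor_space).
  apply/cantor_continuousP => x n.
  have [m mP] := embedding_open (eta g x) n ce ie.
  have [m' m'P] := seq_bound (fun k => c (g^-1 * (d k).1, (d k).2)) (iota 0 m).
  have /cantor_continuousP/(_ x m')[l lP] := ce.
  exists l => x' xx'; apply: mP; rewrite !eeta => k km.
  by apply: lP => //; apply: m'P; rewrite mem_iota.
have eta1 : eta 1 = id.
  apply/funext => x; apply: ie; rewrite eeta; apply/funext => k.
  by rewrite /sigma invg1 mul1g -surjective_pairing dK.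
have etaM g h : eta (g * h) = eta g \o eta h.
  apply/funext => x; apply: ie; rewrite /= !eeta; apply/funext => k.
  by rewrite /sigma cK/= invgM mulgA.
exists eta, (fun x h i => e x (c (h, Some i))); split.
- split; first by apply/XiP.
  apply/top_transitiveP => x x' n.
  have [m mP] := embedding_open x n ce ie.
  have [m' m'P] := embedding_open x' n ce ie.
  pose N := maxn m m'.
  pose F := [seq (d k).1 | k <- iota 0 N].
  pose J := pmap (fun k => (d k).2) (iota 0 N).
  have dF k : k < N -> (d k).1 \in F.
    by move=> kN; apply/mapP; exists k; rewrite ?mem_iota.
  have dJ k i : k < N -> (d k).2 = Some i -> i \in J.
    move=> kN dki; rewrite mem_pmap; apply/mapP.
    by exists k; rewrite ?mem_iota.
  have [g1 g1P] := Ye x F J; have [g2 g2P] := Ye x' F J.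
  (* Outside the excluded list, g moves F off itself, so that the free bits of w
     can be prescribed on F and on g^-1 F independently. *)
  have [t tL tP] := yrec J [seq g2^-1 * h | h <- F]
    [seq g2^-1 * h * h'^-1 * g1 | h <- F, h' <- F].
  pose g := g2 * t * g1^-1.
  pose w : cantor_space := fun k => match d k with
    | (h, Some i) => y (g1^-1 * h) i
    | (h, None) => if h \in F then e x k else e x' (c (g * h, None)) end.
  have Yw : Y w by move=> ? ?; exists g1 => h i _ _; rewrite /w cK.
  exists g, (u w); split.
    apply: mP; rewrite uP// => k km.
    have kN : k < N by rewrite leq_max km.
    have hF := dF k kN; rewrite /w; case dk : (d k) hF => [h [i|]] /= hF.
      by rewrite -g1P ?(dJ k i kN) ?dk// -dk dK.
    by rewrite hF.
  apply: m'P; rewrite eeta uP// => k km.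
  have kN : k < N by rewrite leq_max km orbT.
  have hF := dF k kN; rewrite /sigma /w cK.
  case dk : (d k) hF => [h [i|]] /= hF.
    have iJ : i \in J by apply: (dJ k); rewrite ?dk.
    have -> : g1^-1 * (g^-1 * h) = t^-1 * (g2^-1 * h).
      by rewrite /g !invgM invgK !mulgA mulVg mul1g.
    have /eq_in_map/(_ i iJ) -> := tP _ (map_f (fun h => g2^-1 * h) hF).
    by rewrite -g2P// -dk dK.
  case: ifP => [gF|_]; last by rewrite mulVKg -dk dK.
  exfalso; move/negP: tL; apply; apply/allpairsP; exists (h, g^-1 * h).
  split=> //=; rewrite invgM invgK /g !mulgA mulgK mulVg mul1g.
  by rewrite mulgVK.
- move=> h i; have [m mP] := cantor_unif_continuous (c (h, Some i)).+1 ce.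
  by exists m => x x' /mP; apply.
- by move=> g x h; apply/funext => i; rewrite eeta /sigma cK.
- by move=> x F J; have [g gP] := Ye x F J; exists g.
- exists (u w0); apply/funext => h; apply/funext => i.
  by rewrite uP// /w0 cK.
Qed.

End Realize.
End Actions.

(** * Conjugation into a given neighbourhood *)

Section Conjugation.
Local Open Scope group_scope.
Variable G : groupType.
Implicit Types (g h : G) (F L : seq G).

Lemma conj_class_Xi_tr (xi : map_family G) :
  Xi_tr xi -> conj_class xi `<=` @Xi_tr G.
Proof.
move=> [/XiP[cxi x1 xM] /top_transitiveP tr] eta.
move=> [f [f' [[f'' [_ f''K cf cf'']] fK f'K etaE]]].
have f'E : f' = f'' by apply/funext => y; rewrite -[y in LHS]f''K fK.
have cf' : continuous f' by rewrite f'E.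
split.
  apply/XiP; split.
  - move=> g; rewrite etaE; apply/cantor_continuousP => y n.
    have [m1 H1] := cantor_unif_continuous n cf.
    have [m2 H2] := cantor_unif_continuous m1 (cxi g).
    have [m3 H3] := cantor_unif_continuous m2 cf'.
    by exists m3 => z yz; exact/H1/H2/H3.
  - by rewrite etaE x1; apply/funext => y /=; rewrite f'K.
  - by move=> g h; rewrite !etaE xM; apply/funext => y /=; rewrite fK.
apply/top_transitiveP => y z n.
have [m mP] := cantor_unif_continuous n cf.
have [g [u [yu zu]]] := tr (f' y) (f' z) m.
exists g, (f u); split; first by rewrite -[y]f'K; exact: mP.
by rewrite -[z]f'K etaE /= fK; exact: mP.
Qed.

(** Here [q x h i] stands for bit [i] of letter [h] of a symbolic image of [x].
The hypotheses on [q] say that this image is an equivariant continuous function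
of [x] and displays along [F] exactly the patterns that [eta] displays.  If [f]
exchanges the two partitions into patterns, then [f \o xi h \o f'] and [eta h]
have the same first [n] bits, because both bits are read off the pattern of
the same point; the unit in [F] makes bits of the current point part of the
pattern. *)
Lemma conj_class_near (xi eta : map_family G) F n
    (q : cantor_space -> G -> nat -> bool) :
  Xi xi -> Xi eta -> 1 \in F ->
  (forall h i, exists m, forall x y, agree m x y -> q x h i = q y h i) ->
  (forall g x h, q (xi g x) h = q x (g^-1 * h)) ->
  (forall x, exists w, forall h i, h \in F -> i < n ->
    q x h^-1 i = eta h w i) ->
  (forall w, exists x, forall h i, h \in F -> i < n ->
    q x h^-1 i = eta h w i) ->
  exists2 eta', conj_class xi eta' &
    forall h, h \in F -> forall w, agree n (eta h w) (eta' h w).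
Proof.
move=> /XiP[cxi x1 xM] /XiP[ceta e1 eM] F1 qloc qM qeta etaq.
pose r x := [seq mkseq (q x h^-1) n | h <- F].
pose r' w := [seq mkseq (eta h w) n | h <- F].
have rE x w : r x = r' w <->
    forall h i, h \in F -> i < n -> q x h^-1 i = eta h w i.
  split=> [/eq_in_map H h i /H /(congr1 (nth false ^~ i)) + i_n|H].
    by rewrite !nth_mkseq.
  apply/eq_in_map => h hF; apply/eq_in_map => i.
  by rewrite mem_iota => /H; apply.
have [m rm] : exists m, forall x y, agree m x y -> r x = r y.
  have /choice[s sP] : forall c : G * nat, exists m, forall x y,
      agree m x y -> q x c.1^-1 c.2 = q y c.1^-1 c.2 by move=> c; exact: qloc.
  have [l lP] := seq_bound s [seq (h, i) | h <- F, i <- iota 0 n].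
  exists l => x y xy; apply/eq_in_map => h hF; apply/eq_in_map => i i_n.
  apply: (sP (h, i)); apply: agreeW xy; apply/ltnW/lP/allpairsP.
  by exists (h, i).
have [m' rm'] : exists m, forall x y, agree m x y -> r' x = r' y.
  have /choice[s sP] h := cantor_unif_continuous n (ceta h).
  have [l lP] := seq_bound s F.
  exists l => x y xy; apply/eq_in_map => h hF; apply/eq_in_map => i.
  rewrite mem_iota => i_n; apply: sP => //.
  exact: agreeW (ltnW (lP h hF)) xy.
have rr' : range r = range r'.
  rewrite eqEsubset; split=> _ [x _ <-].
    by have [w /rE ->] := qeta x; exists w.
  by have [w /rE <-] := etaq x; exists w.
have [f [f' [cf cf' fK f'K fP]]] := match_partitions rm rm' rr'.
exists (fun g => f \o xi g \o f').
  by exists f, f'; split=> //; exists f'; split.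
move=> h hF w i i_n /=.
have /rE q1 := esym (fP (f' w)); have /rE q2 := esym (fP (xi h (f' w))).
have := q2 1 i F1 i_n; rewrite e1 /= => <-.
by rewrite qM invg1 mulg1 q1// f'K.
Qed.

End Conjugation.

(** * Subshifts of finite type *)

Section Subshifts.
Local Open Scope group_scope.
Variable G : groupType.
Implicit Types (g h : G) (F L : seq G).

Lemma full_shift_nbhsP (A : finType) (x : full_shift G A)
    (U : set (full_shift G A)) :
  nbhs x U <-> exists F, [set y | forall h, h \in F -> y h = x h] `<=` U.
Proof.
split=> [/(@prod_nbhsP G (fun=> discrete_topology A))[F [V [nV FV]]]|[F FU]].
  exists F => y yx; apply: FV => h /yx ->; exact: nbhs_singleton.
apply/(@prod_nbhsP G (fun=> discrete_topology A)).
by exists F, (fun h => [set x h]); split=> // h; exact: discrete_set1.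
Qed.

(** The map [phi] presents the points of [T] as functions on [G] and identifies
the topology of [T] with a prodiscrete one.  It serves one subshift and a
product of two subshifts alike. *)
Lemma recurrentP (T : topologicalType) (act : G -> T -> T) (X : set T)
    (B : Type) (phi : T -> G -> B) (z : T) :
  (forall y U, nbhs y U <->
    exists F, [set t | forall h, h \in F -> phi t h = phi y h] `<=` U) ->
  (forall g h, phi (act g z) h = phi z (g^-1 * h)) ->
  X z -> (forall g, X (act g z)) ->
  recurrent act X z <-> recurrent_fun (phi z).
Proof.
move=> nbhsE phiM Xz Xact; split=> [[_ H] F L|H].
  have infU : infinite_set [set g |
      (X `&` [set t | forall h, h \in F -> phi t h = phi z h]) (act g z)].
    apply: H => //; rewrite openE => y yz; apply/nbhsE; exists F => t ty h hF.
    by rewrite ty// yz.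
  have [g [[_ Fg] gL]] := infinite_setN0 (infinite_setD infU (finite_seq L)).
  by exists g; [apply/negP|move=> h /Fg; rewrite phiM].
split=> // U oU Uz /finite_seqP[L EL].
have /nbhsE[F FU] := open_nbhs_nbhs (conj oU Uz).
have [g /negP gL gF] := H F L; apply: gL.
suff : [set` L] g by [].
rewrite -EL; split=> //; apply: FU => h /gF; rewrite phiM.
by [].
Qed.

Lemma recurrent_shiftP (A : finType) (X : set (full_shift G A)) x :
  (forall g y, X y -> X (shift g y)) -> X x ->
  recurrent (@shift G A) X x <-> recurrent_fun x.
Proof.
move=> Xinv Xx; apply: (@recurrentP _ _ X A id) => // [|g].
  exact: full_shift_nbhsP.
exact: Xinv.
Qed.

Lemma recurrent_diagP (A1 A2 : finType) (X1 : set (full_shift G A1))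
    (X2 : set (full_shift G A2)) x1 x2 :
  (forall g y, X1 y -> X1 (shift g y)) ->
  (forall g y, X2 y -> X2 (shift g y)) ->
  X1 x1 -> X2 x2 ->
  recurrent (@diag_shift G A1 A2) (X1 `*` X2) (x1, x2) <->
  recurrent_fun (fun h => (x1 h, x2 h)).
Proof.
move=> X1inv X2inv Xx1 Xx2.
apply: (@recurrentP _ (@diag_shift G A1 A2) (X1 `*` X2) (A1 * A2)%type
  (fun (z : full_shift G A1 * full_shift G A2) h => (z.1 h, z.2 h))
  (x1, x2)) => //.
- move=> [y1 y2] U; split.
    move=> [[V1 V2] [/full_shift_nbhsP[F1 FV1] /full_shift_nbhsP[F2 FV2]] VU].
    exists (F1 ++ F2) => -[t1 t2] /= H; apply: VU; split=> /=.
      by apply: FV1 => h hF; have := H h; rewrite mem_cat hF => /(_ isT)[].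
    by apply: FV2 => h hF; have := H h; rewrite mem_cat hF orbT => /(_ isT)[].
  move=> [F FU]; exists ([set t | forall h, h \in F -> t h = y1 h],
    [set t | forall h, h \in F -> t h = y2 h]).
    by split; apply/full_shift_nbhsP; exists F.
  move=> [t1 t2] [/= H1 H2]; apply: FU => h hF /=.
  by rewrite H1 ?H2.
- by move=> g; split; [exact: X1inv|exact: X2inv].
Qed.

Lemma shift1 (A : finType) (x : full_shift G A) : shift 1 x = x.
Proof. by apply/funext => h; rewrite /shift invg1 mul1g. Qed.

Lemma shiftM (A : finType) g h (x : full_shift G A) :
  shift g (shift h x) = shift (g * h) x.
Proof. by apply/funext => k; rewrite /shift invgM mulgA. Qed.

Lemma shiftK (A : finType) g (x : full_shift G A) : shift g^-1 (shift g x) = x.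
Proof. by rewrite shiftM mulVg shift1. Qed.

Definition finitely_determined (B : Type) (W : seq G) (D : set (G -> B)) :=
  forall y z, (forall h, h \in W -> y h = z h) -> D y -> D z.

Lemma cylinder_local (A : finType) (p : {fmap G -> A}) :
  finitely_determined (enum_fset (domf p)) (cylinder p).
Proof.
move=> y z yz py h a pha; have hp : h \in domf p by rewrite -fndSome pha.
by rewrite -(yz h hp); exact: py.
Qed.

(** An SFT is a condition on a finite window, imposed on all translates of a
point.  In this form membership is easily compared between actions that agree on
the window, and conditions are easily combined. *)
Lemma SFT_local (A : finType) (X : set (full_shift G A)) : SFT X ->
  exists W D, finitely_determined W D /\ X = [set x | forall g, D (shift g x)].
Proof.
move=> [_ [P /finite_seqP[s ->] ->]].
exists (flatten [seq enum_fset (domf p) | p : {fmap G -> A} <- s]).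
exists (fun y => forall p, p \in s -> ~ cylinder p y); split.
  move=> y z yz H p ps pz; apply: (H p ps).
  apply: cylinder_local pz => h hp; rewrite yz//.
  by apply/flatten_mapP; exists p.
rewrite eqEsubset; split=> x /=.
  move=> H g p ps pgx; apply: H; exists p => //; exists g^-1 => //.
  by exists (shift g x) => //; rewrite shiftK.
move=> H [p ps [g _ [y py yx]]]; apply: (H g^-1 p ps).
by rewrite -yx shiftK.
Qed.

Lemma cylinder_restrict (A : finType) F (f : {ffun seq_fset tt F -> A})
    (x y : full_shift G A) :
  (forall h (hF : h \in seq_fset tt F), f [` hF]%fset = x h) ->
  cylinder [fmap h : seq_fset tt F => f h]%fmap y <->
  forall h, h \in F -> y h = x h.
Proof.
move=> fx; split=> [fy h hF|H h a].
  have hF' : h \in seq_fset tt F by rewrite seq_fsetE.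
  by apply: fy; rewrite (in_fnd hF') ffunE fx.
have [hF|hF] := boolP (h \in seq_fset tt F); last by rewrite not_fnd.
by rewrite (in_fnd hF) ffunE fx => -[<-]; apply: H; rewrite -(seq_fsetE tt).
Qed.

(** The forbidden patterns are the patterns with domain [W] that violate [D]. *)
Lemma local_SFT (A : finType) W (D : set (full_shift G A)) :
  finitely_determined W D ->
  [set x | forall g, D (shift g x)] !=set0 ->
  SFT [set x | forall g, D (shift g x)].
Proof.
move=> Dloc X0; split.
  split=> // [x clx g|g x /= H h]; last by rewrite shiftM.
  have [|y [Hy yx]] := clx
      [set y | forall h, h \in [seq g^-1 * w | w <- W] -> y h = x h].
    by apply/full_shift_nbhsP; exists [seq g^-1 * w | w <- W].
  apply: Dloc (Hy g) => h hW; apply: yx; exact: map_f.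
pose restr (f : {ffun seq_fset tt W -> A}) : {fmap G -> A} :=
  [fmap h : seq_fset tt W => f h]%fmap.
exists (restr @` [set f | forall y, cylinder (restr f) y -> ~ D y]).
  apply: finite_image; exact: finite_finset.
rewrite eqEsubset; split=> x /=.
  move=> H [_ [f fD <-] [g _ [y fy yx]]]; apply: (fD _ fy).
  by have := H g^-1; rewrite -yx shiftK.
move=> H g; apply: contrapT => nD; apply: H.
pose f := [ffun h : seq_fset tt W => shift g x (val h)].
have cf y : cylinder (restr f) y <-> forall h, h \in W -> y h = shift g x h.
  by apply: cylinder_restrict => h hW; rewrite /f ffunE.
exists (restr f).
  by exists f => // y /cf fy Dy; apply: nD; apply: Dloc Dy.
by exists g^-1 => //; exists (shift g x); [apply/cf|rewrite shiftK].
Qed.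

End Subshifts.

(** * From a dense conjugacy class to joint recurrence *)

Section Necessity.
Local Open Scope group_scope.
Variable G : groupType.
Hypotheses (Gcount : countable [set: G]) (Ginf : infinite_set [set: G]).
Implicit Types (g h : G) (F L : seq G).

(** The symbolic point read from the orbit of [w] through the partition [phi];
the inverse makes the coding equivariant. *)
Definition itinerary (A : Type) (phi : cantor_space -> A) (xi : map_family G)
  (w : cantor_space) : G -> A := fun h => phi (xi h^-1 w).

Lemma itinerary_shift (A : Type) (phi : cantor_space -> A)
    (xi : map_family G) g w :
  Xi xi -> itinerary phi xi (xi g w) = fun h => itinerary phi xi w (g^-1 * h).
Proof.
move=> /XiP[_ _ xM]; apply/funext => h; rewrite /itinerary invgM invgK.
by rewrite xM.
Qed.

Lemma itinerary_local (A : Type) (phi : cantor_space -> A)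
    (xi : map_family G) n F w :
  Xi xi -> (forall x y, agree n x y -> phi x = phi y) ->
  exists m, forall v, agree m w v ->
    forall h, h \in F -> itinerary phi xi v h = itinerary phi xi w h.
Proof.
move=> /XiP[cxi _ _] phin.
have : forall h, exists m, forall v,
    agree m w v -> agree n (xi h^-1 w) (xi h^-1 v).
  by move=> h; have /cantor_continuousP := cxi h^-1; apply.
move=> /choice[r rP]; have [m mF] := seq_bound r F.
exists m => v wv h hF; apply/esym/phin/rP.
exact: agreeW (ltnW (mF h hF)) wv.
Qed.

Lemma itinerary_recurrent (A : Type) (phi : cantor_space -> A)
    (xi : map_family G) n w :
  Xi xi -> (forall x y, agree n x y -> phi x = phi y) ->
  (forall y n L, exists2 g, g \notin L & agree n y (xi g w)) ->
  recurrent_fun (itinerary phi xi w).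
Proof.
move=> xiX phin wdense F L; have [m mP] := itinerary_local F w xiX phin.
have [g gL /mP wg] := wdense w m L; exists g => // h /wg.
by rewrite itinerary_shift.
Qed.

(** A transitive action [eta] realizing [x] has a partition [psi] with
itineraries in [X].  A conjugate of [xi] that is close to [eta] has, for the
same [psi], itineraries equal to those of [eta] on the window defining [X] and
on the domain of [p]; pulling [psi] back by the conjugating homeomorphism [f]
gives the partition for [xi]. *)
Lemma dense_class_coding (xi : map_family G) (A : finType)
    (X : set (full_shift G A)) (p : {fmap G -> A}) x :
  Xi xi -> @Xi_tr G `<=` closure (conj_class xi) ->
  SFT X -> recurrent_fun x -> X x -> occurs p x ->
  exists phi : cantor_space -> A,
    [/\ exists n, forall w w', agree n w w' -> phi w = phi w',
        forall w, X (itinerary phi xi w) &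
        exists w, cylinder p (itinerary phi xi w)].
Proof.
move=> xiX dense /SFT_local[W [D [Dloc ->]]] xrec Xx [g0 px].
have [|eta [pr [trE prloc prM prx [w0 w0x]]]] :=
    @recurrent_realization G Gcount Ginf A (fun h a => x h == a).
  move=> J F L; have [g gL gF] := xrec F L; exists g => // h hF.
  by apply: eq_map => a; rewrite gF.
have etaX := trE.1.
pose psi w : A := odflt (x 1) [pick a | pr w 1 a].
have psiE w (a : A) : (forall b, pr w 1 b = (a == b)) -> psi w = a.
  move=> prw; rewrite /psi; case: pickP => [b|/(_ a)]; rewrite prw ?eqxx//.
  by move=> /eqP ->.
have psi_it w h : pr (eta h^-1 w) 1 = pr w h.
  by rewrite prM invgK mulg1.
have psix w F : exists g, forall h, h \in F ->
    itinerary psi eta w h = x (g^-1 * h).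
  have [g gP] := prx w F (enum A); exists g => h hF; apply: psiE => b.
  by rewrite psi_it gP// mem_enum.
have [n psin] : exists n, forall w w', agree n w w' -> psi w = psi w'.
  have /choice[r rP] := prloc 1; have [n nP] := seq_bound r (enum A).
  exists n => w w' ww'; rewrite /psi; congr odflt; apply: eq_pick => a.
  by apply: rP; apply: agreeW ww'; apply/ltnW/nP; rewrite mem_enum.
(* The group elements that matter are the inverses of the window elements. *)
have [xi' [f [f' [[_ [_ _ cf _]] fK f'K xi'E]]] near] :=
  (map_family_closureP _ _).1 (dense _ trE)
    [seq h^-1 | h <- W ++ enum_fset (domf p)] n.
have itE w h : h \in W ++ enum_fset (domf p) ->
    itinerary (psi \o f) xi w h = itinerary psi eta (f w) h.
  move=> hW; apply: psin; apply: agree_sym.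
  apply: agree_trans (near _ (map_f _ hW) _) _.
  by rewrite xi'E /= fK.
have itD w : D (itinerary (psi \o f) xi w).
  have [g gP] := psix (f w) W; apply: Dloc (Xx g) => h hW.
  by rewrite itE ?mem_cat ?hW// gP.
exists (psi \o f); split.
- have [m mP] := cantor_unif_continuous n cf.
  by exists m => w w' ww'; apply/psin/mP.
- move=> w g; have := itD (xi g w); rewrite itinerary_shift//.
- exists (f' (eta g0 w0)); apply: cylinder_local px => h hp.
  rewrite itE ?mem_cat ?hp ?orbT// f'K.
  by apply/esym/psiE => b; rewrite psi_it prM w0x.
Qed.

Lemma joint_recurrence (xi : map_family G) (A1 A2 : finType)
    (X1 : set (full_shift G A1)) (X2 : set (full_shift G A2))
    (p1 : {fmap G -> A1}) (p2 : {fmap G -> A2}) x1 x2 :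
  Xi_tr xi -> @Xi_tr G `<=` closure (conj_class xi) ->
  SFT X1 -> recurrent_fun x1 -> X1 x1 -> occurs p1 x1 ->
  SFT X2 -> recurrent_fun x2 -> X2 x2 -> occurs p2 x2 ->
  exists y1 y2, [/\ X1 y1, X2 y2, occurs p1 y1, occurs p2 y2 &
    recurrent_fun (fun h => (y1 h, y2 h))].
Proof.
move=> trxi dense S1 r1 Xx1 o1 S2 r2 Xx2 o2; have xiX := trxi.1.
have [phi1 [[n1 phin1] Xphi1 [w1 pw1]]] :=
  dense_class_coding xiX dense S1 r1 Xx1 o1.
have [phi2 [[n2 phin2] Xphi2 [w2 pw2]]] :=
  dense_class_coding xiX dense S2 r2 Xx2 o2.
have [w wdense] := dense_orbit trxi.
have occ (A : finType) (phi : cantor_space -> A) n p v :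
    (forall w w', agree n w w' -> phi w = phi w') ->
    cylinder p (itinerary phi xi v) -> occurs p (itinerary phi xi w).
  move=> phin pv.
  have [m mP] := itinerary_local (enum_fset (domf p)) v xiX phin.
  have [g _ vg] := wdense v m [::]; exists g.
  rewrite /shift -itinerary_shift//.
  by apply: cylinder_local pv => h hp; rewrite mP.
exists (itinerary phi1 xi w), (itinerary phi2 xi w); split=> //.
- exact: occ phin1 pw1.
- exact: occ phin2 pw2.
- apply: (@itinerary_recurrent _ (fun w => (phi1 w, phi2 w)) xi (maxn n1 n2)) =>
    // u v uv.
  rewrite (phin1 u v) 1?(phin2 u v)//; first exact: agreeW (leq_maxr _ _) uv.
  exact: agreeW (leq_maxl _ _) uv.
Qed.

End Necessity.

(** * From joint recurrence to a dense conjugacy class *)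

Section Blocks.
Variable C : countType.

(** Finite alphabets are cut out of the bits indexed by [C] by keeping those
in [J]. *)
Definition block (J : seq C) (v : C -> bool) : {ffun seq_sub J -> bool} :=
  [ffun p => v (ssval p)].

Definition unblock (J : seq C) (a : {ffun seq_sub J -> bool}) : C -> bool :=
  fun c => if insub c is Some p then a p else false.

Lemma blockK (J : seq C) v c : c \in J -> unblock (block J v) c = v c.
Proof. by move=> cJ; rewrite /unblock insubT ffunE. Qed.

Lemma eq_block (J : seq C) v v' : map v J = map v' J -> block J v = block J v'.
Proof.
by move=> /eq_in_map vv'; apply/ffunP => p; rewrite !ffunE vv'// (ssvalP p).
Qed.

End Blocks.

Section Sufficiency.
Local Open Scope group_scope.
Variable G : groupType.
Hypotheses (Gcount : countable [set: G]) (Ginf : infinite_set [set: G]).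
Implicit Types (g h : G) (F L : seq G).

Lemma recurrent_fun_shift (B : Type) (y : G -> B) t :
  recurrent_fun y -> recurrent_fun (fun h => y (t^-1 * h)).
Proof.
move=> yrec F L.
have [g gL gF] := yrec [seq t^-1 * h | h <- F] [seq t^-1 * g * t | g <- L].
exists (t * g * t^-1).
  apply: contra gL => /(map_f (fun g => t^-1 * g * t)).
  by rewrite !mulgA mulVg mul1g mulgVK.
move=> h hF; rewrite -(gF (t^-1 * h)) ?map_f//; congr y.
by rewrite !invgM invgK !mulgA mulVg mul1g.
Qed.

Definition joint_recurrence_property := forall (A1 A2 : finType)
      (X1 : set (full_shift G A1)) (X2 : set (full_shift G A2))
      (p1 : {fmap G -> A1}) (p2 : {fmap G -> A2}),
    SFT X1 -> SFT X2 ->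
    (exists x1, recurrent (@shift G A1) X1 x1 /\ occurs p1 x1) ->
    (exists x2, recurrent (@shift G A2) X2 x2 /\ occurs p2 x2) ->
    exists x1' x2',
      [/\ X1 x1', X2 x2', occurs p1 x1', occurs p2 x2' &
          recurrent (@diag_shift G A1 A2) (X1 `*` X2) (x1', x2')].

Hypothesis JRP : joint_recurrence_property.

(** The joint recurrence property in terms of windows instead of patterns and
SFTs.  Translating the pair places the first window exactly where it was. *)
Lemma joint_local (A1 A2 : finType) W1 W2
    (D1 : set (G -> A1)) (D2 : set (G -> A2))
    (x1 : G -> A1) (x2 : G -> A2) F1 F2 :
  finitely_determined W1 D1 -> finitely_determined W2 D2 ->
  recurrent_fun x1 -> recurrent_fun x2 ->
  (forall g, D1 (shift g x1)) -> (forall g, D2 (shift g x2)) ->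
  exists y1 y2, [/\ forall g, D1 (shift g y1), forall g, D2 (shift g y2),
    forall h, h \in F1 -> y1 h = x1 h,
    exists g, forall h, h \in F2 -> y2 (g^-1 * h) = x2 h &
    recurrent_fun (fun h => (y1 h, y2 h))].
Proof.
move=> D1loc D2loc r1 r2 D1x D2x.
have sft (A : finType) W (D : set (G -> A)) x : finitely_determined W D ->
    (forall g, D (shift g x)) ->
    SFT [set x : full_shift G A | forall g, D (shift g x)].
  by move=> Dloc Dx; apply: local_SFT Dloc _; exists x.
have inv (A : finType) (D : set (G -> A)) g y :
    [set x : full_shift G A | forall g, D (shift g x)] y ->
    [set x : full_shift G A | forall g, D (shift g x)] (shift g y).
  by move=> Dy t; rewrite shiftM.
have pat (A : finType) F (x : G -> A) : exists p : {fmap G -> A}, forall y,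
    cylinder p y <-> forall h, h \in F -> y h = x h.
  exists [fmap h : seq_fset tt F =>
    [ffun h : seq_fset tt F => x (val h)] h]%fmap.
  by move=> y; apply: cylinder_restrict => h hF; rewrite ffunE.
have ex (A : finType) (D : set (G -> A)) F (x : G -> A) p : recurrent_fun x ->
    (forall g, D (shift g x)) ->
    (forall y, cylinder p y <-> forall h, h \in F -> y h = x h) ->
    exists x, recurrent (@shift G A) [set x | forall g, D (shift g x)] x /\
      occurs p x.
  move=> xrec Dx pP; exists x; split.
    by apply/recurrent_shiftP => //; exact: inv.
  by exists 1; apply/pP => h _; rewrite shift1.
have [p1 p1P] := pat _ F1 x1; have [p2 p2P] := pat _ F2 x2.
have [y1 [y2 [Dy1 Dy2 [g1 /p1P y1p] [g2 /p2P y2p] yrec]]] :=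
  JRP (sft _ _ _ _ D1loc D1x) (sft _ _ _ _ D2loc D2x)
      (ex _ _ _ _ _ r1 D1x p1P) (ex _ _ _ _ _ r2 D2x p2P).
exists (shift g1 y1), (shift g1 y2); split=> //.
- by move=> g; rewrite shiftM.
- by move=> g; rewrite shiftM.
- exists (g2 * g1^-1) => h /y2p <-; rewrite /shift invgM invgK.
  by rewrite -!mulgA mulKg.
- move/recurrent_diagP: yrec => yrec.
  apply: (@recurrent_fun_shift _ (fun h => (y1 h, y2 h))); apply: yrec => //.
    exact: inv.
  exact: inv.
Qed.

Variables (idx : G -> nat) (gam : nat -> G).
Hypotheses (idxK : cancel idx gam) (gamK : cancel gam idx).

Definition first_elts k := [seq gam i | i <- iota 0 k].

Lemma mem_first_elts k g : (g \in first_elts k) = (idx g < k).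
Proof.
apply/mapP/idP => [[i]|gk]; first by rewrite mem_iota => + ->; rewrite gamK.
by exists (idx g); rewrite ?mem_iota ?idxK.
Qed.

Lemma sub_first_elts F : exists k, forall g, g \in F -> g \in first_elts k.
Proof.
have [k kP] := seq_bound idx F; exists k => g gF.
by rewrite mem_first_elts kP.
Qed.

(** Task [k] is given by a recurrent point [x k] satisfying the window condition
[D k] everywhere, and asks for a point satisfying [D k] everywhere in which the
restriction of [x k] to [E k] occurs. *)
Section Amalgam.
Variables (W E : nat -> seq G) (n : nat -> nat).
Variables (D : nat -> set (G -> nat -> bool)) (x : nat -> G -> nat -> bool).
Hypothesis Dlocal : forall k y z,
  (forall h i, h \in W k -> i < n k -> y h i = z h i) -> D k y -> D k z.
Hypothesis xrec : forall k, recurrent_bits (x k).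
Hypothesis xD : forall k g, D k (fun h => x k (g^-1 * h)).

(** Channel [k] of [y], that is, the bits [(k, i)] of its letters, performs task
[k], and [y] is recurrent in all channels together.  Stage [k] of the fusion
applies the joint recurrence property to the channels below [k], truncated to
finitely many bits, and to [x k]; the truncation keeps all bits fixed so far
and all bits seen by the earlier conditions.  Channel [k] is put in place only
then, so the birth stage of the coordinate [(h, (j, i))] is its channel [j].
Each [D j] at a given translate, the occurrence of [x k], and one return for
the [k]-th window are decided by finitely many coordinates, so they survive in
the limit. *)
Lemma amalgam : exists y : G -> nat * nat -> bool,
  recurrent_bits y /\
  forall k, (forall g, D k (fun h i => y (g^-1 * h) (k, i))) /\
    exists g, forall h i, h \in E k -> i < n k -> y (g^-1 * h) (k, i) = x k h i.
Proof.
pose Inv k (y : G * (nat * nat) -> bool) :=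
  recurrent_bits (fun h c => y (h, c)) /\
  forall j, j < k -> forall g, D j (fun h i => y (g^-1 * h, (j, i))).
pose Target k (y : G * (nat * nat) -> bool) := [/\
  forall j g, j <= k -> g \in first_elts k ->
    D j (fun h i => y (g^-1 * h, (j, i))),
  exists g, forall h i, h \in E k -> i < n k -> y (g^-1 * h, (k, i)) = x k h i &
  exists2 g, g \notin first_elts k &
    forall h j i, h \in first_elts k -> j <= k -> i <= k ->
    y (g^-1 * h, (j, i)) = y (h, (j, i))].
have [||w wP] := @fusion (G * (nat * nat))%type
    (fun c => maxn (idx c.1) c.2.2) (fun c => c.2.1) Inv Target.
- exists (fun=> false); split=> // J F L.
  have [g gL] := exists_notin Ginf L.
  by exists g.
- move=> k y M [yrec yD].
  have [N nN] := seq_bound n (iota 0 k).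
  pose N' := maxn M N.
  pose J1 := [seq (j, i) | j <- iota 0 k, i <- iota 0 N'].
  pose J2 := iota 0 (n k).
  have inJ1 j i : j < k -> i < N' -> (j, i) \in J1.
    by move=> jk iN; apply/allpairsP; exists (j, i); rewrite !mem_iota.
  pose D1 : set (G -> {ffun seq_sub J1 -> bool}) := fun z =>
    forall j, j < k -> D j (fun h i => unblock (z h) (j, i)).
  pose D2 : set (G -> {ffun seq_sub J2 -> bool}) := fun z =>
    D k (fun h => unblock (z h)).
  have D1loc : finitely_determined (flatten [seq W j | j <- iota 0 k]) D1.
    move=> z z' zz' zD j jk; apply: Dlocal (zD j jk) => h i hW _.
    by rewrite zz'//; apply/flatten_mapP; exists j; rewrite ?mem_iota.
  have D2loc : finitely_determined (W k) D2.
    by move=> z z' zz' zD; apply: Dlocal zD => h i hW _; rewrite zz'.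
  have blockrec (C : countType) (J : seq C) (z : G -> C -> bool) :
      recurrent_bits z -> recurrent_fun (fun h => block J (z h)).
    by move=> /(_ J) zrec F L; have [g gL gF] := zrec F L;
      exists g => // h /gF /eq_block.
  have [||||z1 [z2 [Dz1 Dz2 z1y [g z2x] zrec]]] :=
    @joint_local _ _ _ _ D1 D2 (fun h => block J1 (fun c => y (h, c)))
      (fun h => block J2 (x k h)) (first_elts M) (E k) D1loc D2loc.
  + exact: (blockrec _ _ (fun h c => y (h, c))).
  + exact: blockrec.
  + move=> g j jk; apply: Dlocal (yD j jk g) => h i _ ij.
    rewrite /shift blockK// inJ1// leq_max (ltn_trans ij (nN j _)) ?orbT//.
    by rewrite mem_iota.
  + move=> g; apply: Dlocal (xD k g) => h i _ ik.
    by rewrite /shift blockK// mem_iota.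
  pose y' (c : G * (nat * nat)) := if c.2.1 < k then unblock (z1 c.1) c.2
    else if c.2.1 == k then unblock (z2 c.1) c.2.2 else false.
  have y'ret : recurrent_bits (fun h c => y' (h, c)).
    move=> J F L; have [t tL tF] := zrec F L; exists t => // h /tF[e1 e2].
    by apply: eq_map => c; rewrite /y' /= e1 e2.
  have y'D j : j < k.+1 -> forall g, D j (fun h i => y' (g^-1 * h, (j, i))).
    rewrite ltnS leq_eqVlt /y' => /predU1P[->|jk] t /=.
      by rewrite ltnn eqxx; exact: (Dz2 t).
    by rewrite jk; exact: (Dz1 t).
  have [t tL tP] := y'ret [seq (j, i) | j <- iota 0 k.+1, i <- iota 0 k.+1]
    (first_elts k) (first_elts k).
  (* The group elements on which the requirements of this stage depend. *)
  pose H := [seq h^-1 * w | h <- first_elts k,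
                            w <- flatten [seq W j | j <- iota 0 k.+1]] ++
    [seq g^-1 * h | h <- E k] ++ [seq t^-1 * h | h <- first_elts k] ++
    first_elts k.
  have [M1 M1P] := seq_bound idx H.
  have [M2 M2P] := seq_bound n (iota 0 k.+1).
  exists y', (maxn M1 (maxn M2 k.+1)); split=> //.
    move=> [h [j i]] /=; rewrite gtn_max => /andP[hM iM] jk.
    rewrite /y' /= jk z1y ?mem_first_elts// blockK// inJ1//.
    by rewrite leq_max iM.
  move=> w wy'.
  have {}wy' h j i : h \in H -> j <= k -> (i < n j) || (i <= k) ->
      w (h, (j, i)) = y' (h, (j, i)).
    move=> /M1P hM jk ij; apply: wy' => //=.
    rewrite gtn_max !leq_max hM /= [X in _ || X]orbC; case/orP: ij => ij.
      by rewrite (ltn_trans ij (M2P j _)) ?orbT// mem_iota.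
    by rewrite ltnS ij orbT.
  split.
  + move=> j s jk sk; apply: Dlocal (y'D j jk s) => h i hW ij.
    rewrite wy' ?ij// mem_cat; apply/orP; left; apply/allpairsP.
    exists (s, h); split=> //.
    by apply/flatten_mapP; exists j; rewrite ?mem_iota.
  + exists g => h i hE ik; rewrite wy' ?ik//.
      by rewrite /y' ltnn eqxx /= z2x// blockK// mem_iota.
    by rewrite !mem_cat (map_f (fun h => g^-1 * h) hE) orbT.
  + exists t => // h j i hk jk ik.
    rewrite !wy' ?ik ?orbT//.
    - have /eq_in_map/(_ (j, i)) := tP h hk; apply.
      by apply/allpairsP; exists (j, i); rewrite !mem_iota !ltnS.
    - by rewrite !mem_cat (map_f (fun h => t^-1 * h) hk) !orbT.
    - by rewrite !mem_cat hk !orbT.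
exists (fun h c => w (h, c)); split=> [J F L|k].
  have [m1 m1P] := sub_first_elts F; have [m2 m2P] := sub_first_elts L.
  have [m3 m3P] := seq_bound (fun c => maxn c.1 c.2) J.
  have [_ _ [g gk gP]] := wP (maxn m1 (maxn m2 m3)).
  exists g.
    apply: contra gk => /m2P; rewrite !mem_first_elts => gm.
    by rewrite !leq_max gm orbT.
  move=> h /m1P hm; apply/eq_in_map => -[j i] /m3P /=.
  rewrite gtn_max => /andP[jm im]; apply: gP.
  - by move: hm; rewrite !mem_first_elts => hm; rewrite leq_max hm.
  - by rewrite !leq_max (ltnW jm) !orbT.
  - by rewrite !leq_max (ltnW im) !orbT.
split; last by have [_ H _] := wP k.
move=> g; have [H _ _] := wP (maxn k (idx g).+1); apply: H.
  exact: leq_maxl.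
by rewrite mem_first_elts leq_max ltnSn orbT.
Qed.

End Amalgam.

(** The points that display at the unit one of the patterns of [eta]; imposed on
all translates, this is the SFT of approximate [eta]-orbits. *)
Definition windowed (eta : map_family G) F n : set (G -> nat -> bool) :=
  [set y | exists w, forall h i, h \in F -> i < n -> y h^-1 i = eta h w i].

(** The point [x] is the itinerary of a point [v] of dense orbit.  Every pattern
of [eta] is displayed near [eta g v] for some [g], and by compactness finitely
many [g] are enough: [E] collects the coordinates of [x] at which they are
seen. *)
Lemma windowed_coding (eta : map_family G) F n : Xi_tr eta ->
  exists (x : G -> nat -> bool) (E : seq G), [/\ recurrent_bits x,
    forall g, windowed eta F n (fun h => x (g^-1 * h)) &
    forall y, (forall h i, h \in E -> i < n -> y h i = x h i) ->
    forall w, exists g, forall h i, h \in F -> i < n ->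
      y (g^-1 * h^-1) i = eta h w i].
Proof.
move=> treta; have [v vdense] := dense_orbit treta; have etaX := treta.1.
have [ceta _ eM] := (XiP eta).1 etaX.
have [m mP] : exists m, forall w, exists g, g \in first_elts m /\
    forall h, h \in F -> agree n (eta h w) (eta h (eta g v)).
  apply: cantor_uniform => [a b w ab [g [ga gP]]|w].
    by exists g; split=> //; move: ga; rewrite !mem_first_elts => /leq_trans->.
  have /choice[s sP] h := cantor_unif_continuous n (ceta h).
  have [l lP] := seq_bound s F.
  have [g _ wg] := vdense w l [::].
  exists (maxn l (idx g).+1) => u wu; exists g.
  split; first by rewrite mem_first_elts leq_max ltnSn orbT.
  move=> h hF; apply: sP; apply: agreeW (ltnW (lP h hF)) _.
  by apply: agree_trans wg; apply: agree_sym; exact: agreeW (leq_maxl _ _) wu.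
exists (fun h => eta h^-1 v), [seq g^-1 * h^-1 | g <- first_elts m, h <- F].
split.
- move=> J; have [N NP] := seq_bound id J.
  apply: (@itinerary_recurrent _ _ (fun w : cantor_space => map w J)
    eta N v) => //.
  by move=> a b ab; apply/eq_in_map => i /NP/ab.
- by move=> g; exists (eta g v) => h i _ _; rewrite invgM !invgK eM.
- move=> y yx w; have [g [gm gP]] := mP w; exists g => h i hF i_n.
  rewrite gP// yx//; first by rewrite invgM !invgK eM.
  by apply/allpairsP; exists (g, h).
Qed.

Lemma Xi_tr_inhabited : exists eta, @Xi_tr G eta.
Proof.
have [|eta [p [treta _ _ _ _]]] :=
  @recurrent_realization G Gcount Ginf bool (fun _ _ => false);
  last by exists eta.
by move=> J F L; have [g gL] := exists_notin Ginf L; exists g.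
Qed.

(** On finitely many group elements and up to precision [m], an action is
determined by a modulus of continuity [M] and by the table of its values on
the words of length [M].  There are countably many such data, and one
transitive action is chosen for each that occurs. *)
Lemma Xi_tr_separable : exists eta_ : nat -> map_family G,
  (forall k, Xi_tr (eta_ k)) /\
  forall eta, Xi_tr eta -> forall F n, exists k, forall g, g \in F ->
    forall w, agree n (eta g w) (eta_ k g w).
Proof.
have [eta0 treta0] := Xi_tr_inhabited.
pose word (s : seq bool) : cantor_space := nth false s.
pose table (eta : map_family G) m M :=
  [seq mkseq (eta (gam p.1) (word p.2)) m | p : 'I_m * M.-tuple bool].
pose modulus (eta : map_family G) m M := forall g w w', g \in first_elts m ->
  agree M w w' -> agree m (eta g w) (eta g w').
have /choice[eta_ etaP] : forall k, exists eta, Xi_tr eta /\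
    forall m M T, choice.unpickle k = Some (m, M, T) ->
      (exists eta, [/\ Xi_tr eta, modulus eta m M & table eta m M = T]) ->
      modulus eta m M /\ table eta m M = T.
  move=> k; case: (choice.unpickle k) => [[[m M] T]|]; last by exists eta0.
  have [[eta [tre me te]]|nex] :=
    pselect (exists eta, [/\ Xi_tr eta, modulus eta m M & table eta m M = T]).
    by exists eta; split=> // _ _ _ [<- <- <-].
  by exists eta0; split=> // _ _ _ [<- <- <-].
exists eta_; split=> [k|eta tre F n]; first by have [] := etaP k.
have [ceta _ _] := (XiP eta).1 tre.1.
have [m0 m0P] := seq_bound idx F.
pose m := maxn m0 n.
have /choice[s sP] h := cantor_unif_continuous m (ceta h).
have [M MP] := seq_bound s (first_elts m).
have me : modulus eta m M.
  by move=> g w w' gm ww'; apply: sP; exact: agreeW (ltnW (MP g gm)) ww'.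
have [_ /(_ m M (table eta m M) (choice.pickleK _))[|me' te']] :=
  etaP (choice.pickle (m, M, table eta m M)); first by exists eta.
exists (choice.pickle (m, M, table eta m M)) => g /m0P gm0 w.
have gm : idx g < m by rewrite leq_max gm0.
have gb : g \in first_elts m by rewrite mem_first_elts.
apply: (agreeW (leq_maxr m0 n)).
set u := word (mkseq w M).
have wu : agree M w u by move=> i iM; rewrite /u /word nth_mkseq.
apply: agree_trans (me _ _ _ gb wu) _; apply: agree_sym.
apply: agree_trans (me' _ _ _ gb wu) _ => i im.
move/eq_in_map: te' => /(_ (Ordinal gm, [tuple w i | i < M])).
rewrite mem_enum => /(_ isT) /(congr1 (nth false ^~ i)).
rewrite !nth_mkseq //= idxK => H.
suff -> : u = word [tuple w i | i < M] by [].
by rewrite /u /mkseq -val_enum_ord -map_comp.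
Qed.

(** The tasks are indexed by the pairs of an action of the dense sequence and a
precision, which also bounds the window. *)
Lemma exists_dense_class : has_dense_conj_class (@Xi_tr G).
Proof.
have [eta_ [tre dense]] := Xi_tr_separable.
pose job k := odflt (0, 0) (choice.unpickle k : option (nat * nat)).
pose e k := eta_ (job k).1; pose n k := (job k).2.
pose F k := 1 :: first_elts (n k).
have /choice[x /choice[E xE]] k := windowed_coding (F k) (n k) (tre (job k).1).
have [|||y [yrec yP]] := @amalgam
    (fun k => [seq h^-1 | h <- F k]) E n
    (fun k => windowed (e k) (F k) (n k)) x.
- move=> k z z' zz' [w wP]; exists w => h i hF ik.
  by rewrite -zz' ?wP// map_f.
- by move=> k; have [] := xE k.
- by move=> k; have [] := xE k.
have [xi [p [trxi ploc pM pappr [w0 pw0]]]] :=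
  recurrent_realization Gcount Ginf yrec.
exists xi; split=> //; first exact: conj_class_Xi_tr.
move=> eta treta; apply/map_family_closureP => F' n'.
have [m0 m0P] := seq_bound idx F'.
have [a aP] := dense eta treta F' n'.
pose k := choice.pickle (a, maxn m0 n').
have jk : job k = (a, maxn m0 n') by rewrite /job choice.pickleK.
have [eta' ceta' near] : exists2 eta', conj_class xi eta' &
    forall h, h \in F k -> forall w, agree (n k) (e k h w) (eta' h w).
  apply: (@conj_class_near _ xi (e k) (F k) (n k)
    (fun w h i => p w h (k, i))).
  - exact: trxi.1.
  - exact: (tre _).1.
  - exact: mem_head.
  - by move=> h i; exact: ploc.
  - by move=> g w h; rewrite pM.
  - move=> w.
    have [g gP] := pappr w
      [seq h^-1 | h <- F k] [seq (k, i) | i <- iota 0 (n k)].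
    have [yD _] := yP k; have [v vP] := yD g.
    exists v => h i hF i_n; rewrite -vP// gP ?map_f//.
    by rewrite mem_iota.
  - move=> w; have [_ [g gP]] := yP k.
    have [_ _ /(_ _ gP w)[t tP]] := xE k.
    exists (xi (t * g) w0) => h i hF i_n.
    by rewrite pM pw0 invgM -mulgA tP.
exists eta' => // g gF w; apply: agree_trans (aP g gF w) _.
have := near g; rewrite /e /F /n jk /= inE mem_first_elts => H.
apply: agreeW (leq_maxr m0 n') (H _ w).
by rewrite leq_max m0P ?orbT.
Qed.

End Sufficiency.

Theorem theorem8p2 (G : groupType)
    (hcount : countable [set: G]) (hinf : infinite_set [set: G]) :
  has_dense_conj_class (Xi_tr (G := G))
  <->
  (forall (A1 A2 : finType)
      (X1 : set (full_shift G A1)) (X2 : set (full_shift G A2))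
      (p1 : {fmap G -> A1}) (p2 : {fmap G -> A2}),
    SFT X1 -> SFT X2 ->
    (exists x1, recurrent (@shift G A1) X1 x1 /\ occurs p1 x1) ->
    (exists x2, recurrent (@shift G A2) X2 x2 /\ occurs p2 x2) ->
    exists x1' x2',
      [/\ X1 x1', X2 x2', occurs p1 x1', occurs p2 x2' &
          recurrent (@diag_shift G A1 A2) (X1 `*` X2) (x1', x2')]).
Proof.
split=> [[xi [trxi _ dense]]|JRP].
  move=> A1 A2 X1 X2 p1 p2 S1 S2 [x1 [r1 o1]] [x2 [r2 o2]].
  have [[_ _ inv1] _] := S1; have [[_ _ inv2] _] := S2.
  have [Xx1 Xx2] := (r1.1, r2.1).
  move/recurrent_shiftP: r1 => /(_ inv1 Xx1) r1.
  move/recurrent_shiftP: r2 => /(_ inv2 Xx2) r2.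
  have [y1 [y2 [Xy1 Xy2 oy1 oy2 yrec]]] := joint_recurrence hcount hinf
    trxi dense S1 r1 Xx1 o1 S2 r2 Xx2 o2.
  exists y1, y2; split=> //.
  by apply/recurrent_diagP.
have [idx [gam [idxK gamK]]] := countable_bij hcount hinf.
exact: (exists_dense_class hcount hinf JRP idxK gamK).
Qed.
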